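(* Let $G$ be an $(r,s)$-directed hypergraph. Let $k$ be a positive integer and $a,b$ nonnegative integers with $as=br$, and let $G(k;a,b)$ be the power of $G$. Then $$\rho(G(k;a,b))=\frac{\big(\sqrt{rs}\,\rho(G)\big)^{kr/(kr+a)}}{\sqrt{(kr+a)(ks+b)}}.$$
   Context: Let $r,s$ be positive integers. An $(r,s)$-directed hypergraph $G$ consists of a finite vertex set $V(G)$ and a finite set $E(G)$ of arcs. Each arc $e$ is an ordered pair $(T(e),H(e))$ of disjoint subsets of $V(G)$ (tail and head) with $|T(e)|=r$ and $|H(e)|=s$. Write $T(G)=\bigcup_eT(e)$ and $H(G)=\bigcup_eH(e)$. For real vectors $\mathbf{x}=(x_u)_{u\in T(G)}$ and $\mathbf{y}=(y_v)_{v\in H(G)}$, indexed independently, set $P_G(\mathbf x,\mathbf y)=\sum_{e\in E(G)}\prod_{u\in T(e)}x_u\prod_{v\in H(e)}y_v$. For real $p,q\ge1$ let $\lambda_{p,q}(G)=\max\{P_G(\mathbf x,\mathbf y):\|\mathbf x\|_p=\|\mathbf y\|_q=1\}$. The spectral radius of an $(r,s)$-directed hypergraph is $\rho(G)=\lambda_{2r,2s}(G)$. Power of $G$: for each vertex $u\in V(G)$ take a new set $V_u$ of $k$ vertices, and for each arc $e$ take new sets $T_e$ of $a$ vertices and $H_e$ of $b$ vertices, all these sets pairwise disjoint. Then $G(k;a,b)$ is the $(kr+a,ks+b)$-directed hypergraph with: - vertex set $\bigcup_{u}V_u\cup\bigcup_e(T_e\cup H_e)$; - for each arc $e$ of $G$,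 one arc $\tilde e$ with tail $\bigcup_{u\in T(e)}V_u\cup T_e$ and head $\bigcup_{u\in H(e)}V_u\cup H_e$. Thus $\rho(G(k;a,b))=\lambda_{2(kr+a),2(ks+b)}(G(k;a,b))$. *)

(* Defs.v *)
From HB Require Import structures.
From mathcomp Require Import all_boot all_order all_algebra.
From mathcomp Require Import all_classical all_reals all_analysis.

Set Implicit Arguments.
Unset Strict Implicit.
Unset Printing Implicit Defensive.

Import Order.TTheory GRing.Theory Num.Theory.

Local Open Scope ring_scope.

Section DirectedHypergraph.

Variables (V : finType) (r s : nat).

(* An arc is a pair (tail, head). *)
Definition is_arc (e : {set V} * {set V}) : bool :=
  [&& [disjoint e.1 & e.2], #|e.1| == r & #|e.2| == s].

Record dhypergraph := DHypergraph {
  arcs : {set {set V} * {set V}};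
  arcsP : forall e, e \in arcs -> is_arc e
}.

Definition tails (G : dhypergraph) : {set V} :=
  (\bigcup_(e in arcs G) e.1)%SET.

Definition heads (G : dhypergraph) : {set V} :=
  (\bigcup_(e in arcs G) e.2)%SET.

End DirectedHypergraph.

Section SpectralRadius.

Variable R : realType.

Definition pnorm (V : finType) (p : R) (A : {set V}) (x : V -> R) : R :=
  (\sum_(u in A) `|x u| `^ p) `^ p^-1.

Definition arc_form (V : finType) (r s : nat) (G : dhypergraph V r s)
    (x y : V -> R) : R :=
  \sum_(e in arcs G) (\prod_(u in e.1) x u) * (\prod_(v in e.2) y v).

(* The greatest element of A, and 0 if A has none. *)
Definition set_max (A : set R) : R :=
  xget 0 [set m | A m /\ ubound A m]%classic.

(* Vectors indexed by T(G) and H(G) are encoded as total functions on V: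
   neither arc_form nor the two norms depend on the other coordinates.
   If G has no arc then there are no unit vectors and the value is 0. *)
Definition lambda (p q : R) (V : finType) (r s : nat)
    (G : dhypergraph V r s) : R :=
  set_max [set arc_form G x y | x in [set x | pnorm p (tails G) x = 1]
                              & y in [set y | pnorm q (heads G) y = 1]]%classic.

Definition rho (V : finType) (r s : nat) (G : dhypergraph V r s) : R :=
  lambda (2 * r)%:R (2 * s)%:R G.

End SpectralRadius.

Arguments rho R {V r s} G.

Section Power.

Variables (V : finType) (r s : nat) (G : dhypergraph V r s) (k a b : nat).

Definition arc_of : finType := {e : {set V} * {set V} | e \in arcs G}.

(* inl (u, i) ranges over V_u, inr (e, inl i) over T_e, inr (e, inr j) over
   H_e. *)
Definition power_vertex : finType :=
  ((V * 'I_k) + (arc_of * ('I_a + 'I_b)))%type.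

Definition blowup (A : {set V}) : {set power_vertex} :=
  [set inl ui | ui in finset.setX A [set: 'I_k]]%SET.

Definition new_tail (e : arc_of) : {set power_vertex} :=
  [set inr (e, inl i) | i in [set: 'I_a]]%SET.

Definition new_head (e : arc_of) : {set power_vertex} :=
  [set inr (e, inr j) | j in [set: 'I_b]]%SET.

Definition power_arc (e : arc_of) : {set power_vertex} * {set power_vertex} :=
  (blowup (val e).1 :|: new_tail e, blowup (val e).2 :|: new_head e)%SET.

Definition power_arcs : {set {set power_vertex} * {set power_vertex}} :=
  [set power_arc e | e in [set: arc_of]]%SET.

Lemma card_blowup (A : {set V}) : #|blowup A| = (k * #|A|)%N.
Proof.
rewrite card_imset; last by move=> x y [].
by rewrite cardsX cardsT card_ord mulnC.
Qed.

Lemma power_arcsP e : e \in power_arcs -> is_arc (k * r + a) (k * s + b) e.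
Proof.
case/imsetP=> f _ ->; have /and3P[dis /eqP cr /eqP cs] := arcsP (valP f).
have cT : #|new_tail f| = a.
  by rewrite card_imset ?cardsT ?card_ord // => i j [].
have cH : #|new_head f| = b.
  by rewrite card_imset ?cardsT ?card_ord // => i j [].
rewrite /is_arc /= !cardsU !card_blowup cr cs cT cH.
have -> : (blowup (val f).1 :&: new_tail f = finset.set0)%SET.
  apply/finset.setP=> x; rewrite !inE; apply/negP.
  by case/andP=> /imsetP[? _ ->] /imsetP[].
have -> : (blowup (val f).2 :&: new_head f = finset.set0)%SET.
  apply/finset.setP=> x; rewrite !inE; apply/negP.
  by case/andP=> /imsetP[? _ ->] /imsetP[].
rewrite cards0 !subn0 !eqxx !andbT.
apply/pred0P=> x /=; rewrite !inE; apply/negP.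
case/andP=> /orP[] /imsetP[u uT ->] /orP[] /imsetP[v vH] //.
case=> uv; move: uT vH; rewrite -uv !inE !andbT => uT.
by rewrite (disjointFr dis uT).
Qed.

Definition power : dhypergraph power_vertex (k * r + a) (k * s + b) :=
  DHypergraph power_arcsP.

End Power.

(* Main.v *)
(* Put N = kr + a, M = ks + b and theta = kr / N; the hypothesis as = br says
   exactly that theta = ks / M, hence 1 - theta = a / N = b / M.
   Upper bound: AM-GM inside each block V_u, T_e, H_e replaces the entries of a
   vector by a power mean, so that the monomial of an arc of the power is at
   most F_e ^ theta * D_e ^ (1 - theta), where F_e is the monomial of e in G at
   the block means and D_e is the geometric mean of the means over T_e and H_e.
   Weighted AM-GM, tuned to the extremal vectors, makes this linear in F_e and
   D_e; the sum of the F_e is controlled by rho(G), and the unit norms add up.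
   Equality: spread an extremal pair (x, y) of G over the blocks, giving every
   vertex of T_e and H_e a weight proportional to F_e. *)
Require Import Defs.
From mathcomp Require Import all_boot all_order all_algebra.
From mathcomp Require Import all_classical all_reals all_analysis.
From mathcomp Require Import ring lra zify.

Set Implicit Arguments.
Unset Strict Implicit.
Unset Printing Implicit Defensive.

Import Order.TTheory GRing.Theory Num.Theory.
Local Open Scope ring_scope.

(** * Scalar inequalities of AM-GM type *)

Lemma powR_weighted_AGM (R : realType) (t x y : R) :
  0 < t <= 1 -> 0 <= x -> 0 <= y ->
  x `^ t * y `^ (1 - t) <= t * x + (1 - t) * y.
Proof.
case/andP=> t0; rewrite le_eqVlt => /predU1P[->|t1] x0 y0.
  (* The endpoint [t = 1], which occurs later when [a = 0], has no finite conjugate exponent and is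
     checked directly. *)
  by rewrite subrr powRr0 powRr1// mul1r mul0r addr0 mulr1.
have t1' : 0 < 1 - t by rewrite subr_gt0.
(* Young's inequality with conjugate exponents [1 / t] and [1 / (1 - t)]. *)
have := conjugate_powR (powR_ge0 x t) (powR_ge0 y (1 - t)) (p := t^-1)
  (q := (1 - t)^-1).
rewrite -!powRrM !invrK !mulfV ?gt_eqF// !powRr1// !invr_gt0 t0 t1'.
by rewrite (mulrC x) (mulrC y); apply => //; ring.
Qed.

(** AM-GM for the numbers [|E i| ^+ p], followed by a [p]-th root. For [n = 0] the exponent on the
    right is 0 and both sides are 1, so empty blocks are covered. *)
Lemma ler_norm_prod_mean (R : realType) (n p : nat) (E : 'I_n -> R) :
  (0 < p)%N ->
  `|\prod_i E i|
    <= ((\sum_i `|E i| ^+ p) / n%:R) `^ (n%:R / p%:R).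
Proof.
move=> p0; have p0' : p%:R != 0 :> R by rewrite pnatr_eq0 -lt0n.
set mu := (\sum_i _) / _.
have mu0 : 0 <= mu by rewrite divr_ge0// sumr_ge0// => i _; rewrite exprn_ge0.
have h : `|\prod_i E i| ^+ p <= mu ^+ n.
  have [+ _] := leif_AGM (A := 'I_n) (fun i _ => exprn_ge0 p (normr_ge0 (E i))).
  by rewrite card_ord prodrXl -normr_prod.
rewrite powRrM powR_mulrn//.
rewrite -[leLHS]powRr1// -[X in _ `^ X](mulfV p0') powRrM powR_mulrn//.
by rewrite ge0_ler_powR// ?invr_ge0 ?nnegrE ?exprn_ge0.
Qed.

(** * Maxima and unit vectors *)

Lemma set_max_eq (R : realType) (A : set R) (m : R) :
  A m -> ubound A m -> set_max A = m.
Proof.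
move=> Am ubm; apply: xget_unique => //= n [An ubn].
by apply/eqP; rewrite eq_le ubm// ubn.
Qed.

Lemma pnorm_eq1 (R : realType) (V : finType) (n : nat) (A : {set V})
    (x : V -> R) : (0 < n)%N ->
  (pnorm n%:R A x = 1) <-> (\sum_(u in A) `|x u| ^+ n = 1).
Proof.
move=> n0; rewrite /pnorm; under eq_bigr do rewrite powR_mulrn//.
split=> [/eqP|->]; last by rewrite powR1.
rewrite powR_eq1 invr_eq0 pnatr_eq0 (gtn_eqF n0) orbF => /orP[/eqP//|].
by rewrite ltNge sumr_ge0// => i _; rewrite exprn_ge0.
Qed.

(** Factors [x] on [A] into its norm and a unit direction. When [x] vanishes on [A] there is nothing
    to normalise, and [z] serves as the direction. *)
Lemma pnormalize (R : realType) (V : finType) (n : nat) (A : {set V})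
    (x z : V -> R) : (0 < n)%N -> \sum_(u in A) `|z u| ^+ n = 1 ->
  exists2 x', \sum_(u in A) `|x' u| ^+ n = 1 &
    {in A, forall u, x u = (\sum_(w in A) `|x w| ^+ n) `^ n%:R^-1 * x' u}.
Proof.
move=> n0 z1; have n0' : n%:R != 0 :> R by rewrite pnatr_eq0 -lt0n.
set X := \sum_(w in A) `|x w| ^+ n.
have X0 : 0 <= X by rewrite sumr_ge0// => i _; exact: exprn_ge0.
have [XE|XN] := eqVneq X 0.
  exists z => // u uA; rewrite XE powR0 ?invr_eq0// mul0r.
  move/eqP: XE; rewrite psumr_eq0 => [/allP/(_ u)|i _]; last exact: exprn_ge0.
  by rewrite mem_index_enum uA expf_eq0 n0 normr_eq0 => /(_ isT)/eqP.
set c := X `^ n%:R^-1.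
have cN : c != 0 by rewrite gt_eqF// powR_gt0// lt0r XN.
exists (fun u => c^-1 * x u) => [|u _]; last by rewrite mulVKf.
under eq_bigr do rewrite normrM exprMn.
rewrite -mulr_sumr -/X normfV exprVn ger0_norm ?powR_ge0//.
by rewrite -powR_mulrn ?powR_ge0// -powRrM mulVf// powRr1// mulVf.
Qed.

(** * Maximisation of the arc form and basic properties of the spectral radius *)

Section ArcForm.
Context {R : realType} {V : finType} {r s : nat}.
Implicit Types (G : dhypergraph V r s) (x y : V -> R).

Lemma arc_tailP G e u : e \in arcs G -> u \in e.1 -> u \in tails G.
Proof. by move=> eG ue; apply/bigcupP; exists e. Qed.

Lemma arc_headP G e u : e \in arcs G -> u \in e.2 -> u \in heads G.
Proof. by move=> eG ue; apply/bigcupP; exists e. Qed.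

Lemma eq_arc_form G x x' y y' :
  {in tails G, x =1 x'} -> {in heads G, y =1 y'} ->
  arc_form G x y = arc_form G x' y'.
Proof.
move=> xx yy; apply: eq_bigr => e eG; congr (_ * _); apply: eq_bigr => u ue.
  by rewrite xx// (arc_tailP eG).
by rewrite yy// (arc_headP eG).
Qed.

Lemma ler_arc_form_norm G x y :
  arc_form G x y <= arc_form G (fun u => `|x u|) (fun u => `|y u|).
Proof.
apply: ler_sum => e _; rewrite -!normr_prod -normrM; exact: ler_norm.
Qed.

Lemma arc_form_scale G (c d : R) x y :
  arc_form G (fun u => c * x u) (fun u => d * y u)
  = c ^+ r * d ^+ s * arc_form G x y.
Proof.
rewrite /arc_form mulr_sumr; apply: eq_bigr => e eG.
have /and3P[_ /eqP cr /eqP cs] := arcsP eG.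
by rewrite !big_split !prodr_const cr cs mulrACA.
Qed.

Import ArrowAsProduct.
Import numFieldNormedType.Exports.

(** Extreme value theorem on the nonnegative unit pairs. Replacing entries by absolute values keeps
    the norms and does not lower the form, so a maximiser among nonnegative pairs dominates all
    pairs. *)
Lemma arc_form_max G (p q : nat) : (0 < p)%N -> (0 < q)%N ->
  tails G != finset.set0 -> heads G != finset.set0 ->
  exists x y, [/\ forall u, 0 <= x u, forall v, 0 <= y v,
    \sum_(u in tails G) `|x u| ^+ p = 1,
    \sum_(v in heads G) `|y v| ^+ q = 1 &
    forall x' y', \sum_(u in tails G) `|x' u| ^+ p = 1 ->
      \sum_(v in heads G) `|y' v| ^+ q = 1 ->
      arc_form G x' y' <= arc_form G x y].
Proof.
move=> p0 q0 /set0Pn[u0 u0T] /set0Pn[v0 v0H].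
(* A pair of vectors is a single point of the product space indexed by [V + V], where Tychonoff
   makes the unit cube compact. *)
pose T := V + V -> R.
pose box : set T := [set f | forall i, `[0, 1]%classic (f i)]%classic.
pose cst1 : set T := [set f : T | \sum_(u in tails G) `|f (inl u)| ^+ p = 1]%classic.
pose cst2 : set T := [set f : T | \sum_(v in heads G) `|f (inr v)| ^+ q = 1]%classic.
have cproj i : continuous (fun f : T => f i) by exact: proj_continuous.
have csum (P : pred V) (n : nat) (h : V -> V + V) :
    continuous (fun f : T => \sum_(u | P u) `|f (h u)| ^+ n).
  apply: continuous_big => [|u _ f]; first exact: add_continuous.
  apply: (@continuous_comp _ _ _ (fun f : T => `|f (h u)|) (@GRing.exp R ^~ n)).
    apply: (@continuous_comp _ _ _ (fun f : T => f (h u)) Num.norm).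
      exact: cproj.
    exact: norm_continuous.
  exact: exprn_continuous.
have cbox : compact (box `&` (cst1 `&` cst2))%classic.
  apply: compact_closedI.
    apply: (@tychonoff _ (fun=> R) (fun=> `[0, 1]%classic)) => i.
    exact: segment_compact.
  apply: closedI.
    have /continuous_closedP := csum (mem (tails G)) p inl.
    by move=> /(_ [set 1]%classic (@closed_eq _ 1)).
  have /continuous_closedP := csum (mem (heads G)) q inr.
  by move=> /(_ [set 1]%classic (@closed_eq _ 1)).
pose F (f : T) := arc_form G (fun u => f (inl u)) (fun u => f (inr u)).
have cF : continuous F.
  apply: continuous_big => [|e _ f]; first exact: add_continuous.
  apply: (@continuousM _ _ (fun f : T => \prod_(u in e.1) f (inl u))
    (fun f : T => \prod_(u in e.2) f (inr u))).
    apply: continuous_big => [|u _ g]; first exact: mul_continuous.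
    exact: cproj.
  apply: continuous_big => [|u _ g]; first exact: mul_continuous.
  exact: cproj.
(* Entries outside the tails and heads are not bounded by the norms; setting them to 0 brings the
   pair into the cube without changing the form. *)
pose ext x y : T := fun i => match i with
  | inl u => if u \in tails G then `|x u| else 0
  | inr v => if v \in heads G then `|y v| else 0 end.
have le1 (A : {set V}) (n : nat) (z : V -> R) v : (0 < n)%N ->
    \sum_(u in A) `|z u| ^+ n = 1 -> v \in A -> `|z v| <= 1.
  move=> n0 + vA; rewrite (bigD1 v)//= => z1.
  rewrite -(@expr_le1 _ n)// -z1 lerDl sumr_ge0//.
have ext_in x y : \sum_(u in tails G) `|x u| ^+ p = 1 ->
    \sum_(v in heads G) `|y v| ^+ q = 1 -> (box `&` (cst1 `&` cst2))%classic (ext x y).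
  move=> x1 y1; split; [|split] => /=.
  - case=> u /=; rewrite in_itv /=; case: ifPn; rewrite ?lexx ?ler01// => uA.
      by rewrite normr_ge0/= (le1 _ _ _ _ _ x1).
    by rewrite normr_ge0/= (le1 _ _ _ _ _ y1).
  - rewrite /cst1/= -[RHS]x1; by apply: eq_bigr => u ->; rewrite normr_id.
  - rewrite /cst2/= -[RHS]y1; by apply: eq_bigr => u ->; rewrite normr_id.
(* Unit vectors supported at one tail vertex and at one head vertex show that the compact set is
   nonempty. *)
have delta_sum (A : {set V}) (n : nat) v : (0 < n)%N -> v \in A ->
    \sum_(u in A) `|(u == v)%:R : R| ^+ n = 1.
  move=> n0 vA; rewrite (bigD1 v)//= eqxx normr1 expr1n big1 ?addr0// => u.
  by case/andP=> _ /negbTE->; rewrite normr0 expr0n gtn_eqF.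
have [|c] := compact_EVT_max _ cbox (continuous_subspaceT cF).
  by eexists; apply: ext_in; apply: delta_sum; [|exact: u0T| |exact: v0H].
rewrite inE => -[cb [c1 c2]] cmax.
exists (fun u => c (inl u)), (fun v => c (inr v)); split=> //.
- by move=> u; have := cb (inl u); rewrite /= in_itv/= => /andP[].
- by move=> u; have := cb (inr u); rewrite /= in_itv/= => /andP[].
move=> x y x1 y1; apply: le_trans (cmax (ext x y) _); last by rewrite inE; exact: ext_in.
rewrite (le_trans (ler_arc_form_norm G x y))// le_eqVlt; apply/predU1P; left.
by apply: eq_arc_form => u /= ->.
Qed.

(** Homogeneity removes the normalisation. The form has degree [r] in [x], and the [r]-th power of
    the [2 * r]-norm is a square root of the power sum; likewise for [y] with [s]. *)
Lemma arc_form_le_sqrt G x y m : (0 < r)%N -> (0 < s)%N ->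
  (exists x0, \sum_(u in tails G) `|x0 u| ^+ (2 * r) = 1) ->
  (exists y0, \sum_(v in heads G) `|y0 v| ^+ (2 * s) = 1) ->
  (forall x' y', \sum_(u in tails G) `|x' u| ^+ (2 * r) = 1 ->
     \sum_(v in heads G) `|y' v| ^+ (2 * s) = 1 -> arc_form G x' y' <= m) ->
  arc_form G x y <= m * (Num.sqrt (\sum_(u in tails G) `|x u| ^+ (2 * r)) *
                         Num.sqrt (\sum_(v in heads G) `|y v| ^+ (2 * s))).
Proof.
move=> r0 s0 [x0 x01] [y0 y01] ub.
have half (n : nat) (X : R) : (0 < n)%N -> 0 <= X ->
    (X `^ (2 * n)%:R^-1) ^+ n = Num.sqrt X.
  move=> n0 X0; rewrite -powR_mulrn ?powR_ge0// -powRrM -powR12_sqrt//.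
  by rewrite natrM invfM mulfVK// pnatr_eq0 -lt0n.
have sum_ge0 (A : {set V}) (n : nat) (z : V -> R) :
    0 <= \sum_(u in A) `|z u| ^+ n.
  by rewrite sumr_ge0// => i _; exact: exprn_ge0.
have [|x1 x11 xE] := pnormalize x _ x01; first by rewrite muln_gt0.
have [|y1 y11 yE] := pnormalize y _ y01; first by rewrite muln_gt0.
rewrite (eq_arc_form xE yE) arc_form_scale !half// mulrC.
by rewrite ler_wpM2r ?mulr_ge0 ?sqrtr_ge0// ub.
Qed.

Lemma rho_eq G x y : (0 < r)%N -> (0 < s)%N ->
  \sum_(u in tails G) `|x u| ^+ (2 * r) = 1 ->
  \sum_(v in heads G) `|y v| ^+ (2 * s) = 1 ->
  (forall x' y', \sum_(u in tails G) `|x' u| ^+ (2 * r) = 1 ->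
     \sum_(v in heads G) `|y' v| ^+ (2 * s) = 1 ->
     arc_form G x' y' <= arc_form G x y) ->
  rho R G = arc_form G x y.
Proof.
move=> r0 s0 x1 y1 ub; apply: set_max_eq.
  exists x; first by apply/pnorm_eq1; rewrite ?muln_gt0.
  by exists y => //; apply/pnorm_eq1; rewrite ?muln_gt0.
move=> _ [x' /pnorm_eq1 x'1 [y' /pnorm_eq1 y'1 <-]].
by apply: ub; [apply: x'1|apply: y'1]; rewrite muln_gt0.
Qed.

Lemma rhoP G : (0 < r)%N -> (0 < s)%N -> arcs G != finset.set0 ->
  [/\ 0 < rho R G,
    forall x y, arc_form G x y <=
      rho R G * (Num.sqrt (\sum_(u in tails G) `|x u| ^+ (2 * r)) *
                 Num.sqrt (\sum_(v in heads G) `|y v| ^+ (2 * s))) &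
    exists x y, [/\ forall u, 0 <= x u, forall v, 0 <= y v,
      \sum_(u in tails G) `|x u| ^+ (2 * r) = 1,
      \sum_(v in heads G) `|y v| ^+ (2 * s) = 1 &
      arc_form G x y = rho R G]].
Proof.
move=> r0 s0 G0; have /set0Pn[e eG] := G0.
have /and3P[_ /eqP cr /eqP cs] := arcsP eG.
have [u ue] : exists u, u \in e.1 by apply/set0Pn; rewrite -card_gt0 cr.
have [v ve] : exists v, v \in e.2 by apply/set0Pn; rewrite -card_gt0 cs.
have TG : tails G != finset.set0 by apply/set0Pn; exists u; exact: arc_tailP ue.
have HG : heads G != finset.set0 by apply/set0Pn; exists v; exact: arc_headP ve.
have [||x [y [x0 y0 x1 y1 ub]]] := arc_form_max (p := 2 * r) (q := 2 * s) _ _ TG HG.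
- by rewrite muln_gt0.
- by rewrite muln_gt0.
rewrite (rho_eq r0 s0 x1 y1 ub).
have ub' x' y' := arc_form_le_sqrt (G := G) x' y' r0 s0 (ex_intro _ x x1)
  (ex_intro _ y y1) ub.
split=> //; last by exists x, y.
(* Positivity: at the all-ones vectors the form is the number of arcs, which is positive. *)
have := ub' (fun=> 1) (fun=> 1).
rewrite {1}/arc_form; under eq_bigr do rewrite !big1// mulr1.
rewrite sumr_const; set t := Num.sqrt _ * _ => h.
have mt_gt0 : 0 < arc_form G x y * t by rewrite (lt_le_trans _ h)// ltr0n card_gt0.
have : 0 <= t by rewrite mulr_ge0 ?sqrtr_ge0.
rewrite le_eqVlt => /predU1P[tE|t0]; last by rewrite -(pmulr_lgt0 _ t0).
by move: mt_gt0; rewrite -tE mulr0 ltxx.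
Qed.

Lemma rho_no_arc G : (0 < r)%N -> arcs G = finset.set0 -> rho R G = 0.
Proof.
move=> r0 G0; apply: xgetPN => m [[x /= + _] _].
rewrite pnorm_eq1 ?muln_gt0// /tails G0 big_set0 big_set0.
by move/eqP; rewrite eq_sym oner_eq0.
Qed.

End ArcForm.

(** * Sums and products over the vertices of the power *)

Section PowerSums.
Context {V : finType} {r s : nat} (G : dhypergraph V r s) (k a b : nat).
Notation W := (power_vertex G k a b).

Lemma mem_power_tail (e : arc_of G) (w : W) :
  (w \in (power_arc k a b e).1) =
  match w with
  | inl (u, _) => u \in (val e).1
  | inr (f, inl _) => f == e
  | inr (_, inr _) => false
  end.
Proof.
rewrite inE; case: w => [[u i]|[f [i|j]]].
- rewrite (mem_imset _ _ (@inl_inj _ _)) !inE andbT.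
  by rewrite (_ : _ \in new_tail _ _ _ _ = false) ?orbF//; apply/negbTE/negP => /imsetP[].
- rewrite (_ : _ \in blowup _ _ _ _ _ = false); last by apply/negbTE/negP => /imsetP[].
  by apply/imsetP/eqP => [[? _ [-> _]]//|->]; exists i.
- by apply/negbTE/negP => /orP[] /imsetP[].
Qed.

Lemma mem_power_head (e : arc_of G) (w : W) :
  (w \in (power_arc k a b e).2) =
  match w with
  | inl (u, _) => u \in (val e).2
  | inr (_, inl _) => false
  | inr (f, inr _) => f == e
  end.
Proof.
rewrite inE; case: w => [[u i]|[f [i|j]]].
- rewrite (mem_imset _ _ (@inl_inj _ _)) !inE andbT.
  by rewrite (_ : _ \in new_head _ _ _ _ = false) ?orbF//; apply/negbTE/negP => /imsetP[].
- by apply/negbTE/negP => /orP[] /imsetP[].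
- rewrite (_ : _ \in blowup _ _ _ _ _ = false); last by apply/negbTE/negP => /imsetP[].
  by apply/imsetP/eqP => [[? _ [-> _]]//|->]; exists j.
Qed.

(** Since [0 < k], every block contains the copy of index 0, and testing these copies recovers the
    tail and head of the original arc. The arcs of the power can thus be indexed by those of [G]. *)
Lemma power_arc_inj : (0 < k)%N -> injective (@power_arc _ _ _ G k a b).
Proof.
move=> k0 e f ef; apply: val_inj; pose i := Ordinal k0.
rewrite [val e]surjective_pairing [val f]surjective_pairing.
congr (_, _); apply/finset.setP => u.
  by have := mem_power_tail e (inl (u, i)); rewrite ef mem_power_tail.
by have := mem_power_head e (inl (u, i)); rewrite ef mem_power_head.
Qed.

Lemma mem_tails_power (w : W) :
  (w \in tails (power G k a b)) =
  match w with
  | inl (u, _) => u \in tails G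
  | inr (_, inl _) => true
  | inr (_, inr _) => false
  end.
Proof.
apply/bigcupP/idP => [[_ /imsetP[e _ ->]]|].
  rewrite mem_power_tail; case: w => [[u i] ue|[f [i|j]]]//.
  exact: arc_tailP (valP e) ue.
case: w => [[u i] /bigcupP[e eG ue]|[f [i|j]]]//.
  exists (power_arc k a b (Sub e eG : arc_of G)); first exact: imset_f.
  by rewrite mem_power_tail.
move=> _; exists (power_arc k a b f); first exact: imset_f.
by rewrite mem_power_tail eqxx.
Qed.

Lemma mem_heads_power (w : W) :
  (w \in heads (power G k a b)) =
  match w with
  | inl (u, _) => u \in heads G
  | inr (_, inl _) => false
  | inr (_, inr _) => true
  end.
Proof.
apply/bigcupP/idP => [[_ /imsetP[e _ ->]]|].
  rewrite mem_power_head; case: w => [[u i] ue|[f [i|j]]]//.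
  exact: arc_headP (valP e) ue.
case: w => [[u i] /bigcupP[e eG ue]|[f [i|j]]]//.
  exists (power_arc k a b (Sub e eG : arc_of G)); first exact: imset_f.
  by rewrite mem_power_head.
move=> _; exists (power_arc k a b f); first exact: imset_f.
by rewrite mem_power_head eqxx.
Qed.

Section BigPower.
Context {R : Type} {idx : R} {op : Monoid.com_law idx}.

(** One splitting along the three kinds of blocks serves the tail and head of a single arc and those
    of the whole power, by choice of [A], [E1], [E2]. The operation is generic because monomials
    need products and norms need sums. *)
Lemma big_power_vertex (A : pred V) (E1 E2 : pred (arc_of G)) (F : W -> R) :
  \big[op/idx]_(w : W | match w with
                        | inl (u, _) => A u
                        | inr (f, inl _) => E1 f
                        | inr (f, inr _) => E2 f
                        end) F w =
  op (\big[op/idx]_(u | A u) \big[op/idx]_(i < k) F (inl (u, i)))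
     (op (\big[op/idx]_(f | E1 f) \big[op/idx]_(i < a) F (inr (f, inl i)))
         (\big[op/idx]_(f | E2 f) \big[op/idx]_(j < b) F (inr (f, inr j)))).
Proof.
rewrite big_sumType; congr (op _ _).
  rewrite pair_big; apply: eq_big => [[u i]|[u i] _]//=.
  by rewrite andbT.
rewrite (eq_bigr (fun p => F (inr (p.1, p.2)))) => [|[]//].
rewrite (eq_bigl (fun p => true && (match p.2 with
  | inl _ => E1 p.1 | inr _ => E2 p.1 end))) => [|[f []]//].
rewrite -(pair_big_dep xpredT (fun f x => match x with inl _ => E1 f | inr _ => E2 f end)
  (fun f x => F (inr (f, x)))) /=.
(* Both restricted operators are padded with [idx] to range over all arcs, so that they merge and
   can be compared arc by arc. *)
rewrite [X in op X _]big_mkcond [X in op _ X]big_mkcond -big_split/=.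
apply: eq_bigr => f _; rewrite big_sumType/=.
by congr (op _ _); case: ifP => // _; rewrite big_pred0_eq.
Qed.

Lemma big_power_tail (e : arc_of G) (F : W -> R) :
  \big[op/idx]_(w in (power_arc k a b e).1) F w =
  op (\big[op/idx]_(u in (val e).1) \big[op/idx]_(i < k) F (inl (u, i)))
     (\big[op/idx]_(i < a) F (inr (e, inl i))).
Proof.
rewrite (eq_bigl _ _ (mem_power_tail e)).
by rewrite (big_power_vertex (mem (val e).1) (pred1 e) pred0) big_pred1_eq
  big_pred0_eq Monoid.mulm1.
Qed.

Lemma big_power_head (e : arc_of G) (F : W -> R) :
  \big[op/idx]_(w in (power_arc k a b e).2) F w =
  op (\big[op/idx]_(u in (val e).2) \big[op/idx]_(i < k) F (inl (u, i)))
     (\big[op/idx]_(j < b) F (inr (e, inr j))).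
Proof.
rewrite (eq_bigl _ _ (mem_power_head e)).
by rewrite (big_power_vertex (mem (val e).2) pred0 (pred1 e)) big_pred1_eq
  big_pred0_eq Monoid.mul1m.
Qed.

Lemma big_tails_power (F : W -> R) :
  \big[op/idx]_(w in tails (power G k a b)) F w =
  op (\big[op/idx]_(u in tails G) \big[op/idx]_(i < k) F (inl (u, i)))
     (\big[op/idx]_(e : arc_of G) \big[op/idx]_(i < a) F (inr (e, inl i))).
Proof.
rewrite (eq_bigl _ _ mem_tails_power).
by rewrite (big_power_vertex (mem (tails G)) predT pred0) big_pred0_eq Monoid.mulm1.
Qed.

Lemma big_heads_power (F : W -> R) :
  \big[op/idx]_(w in heads (power G k a b)) F w =
  op (\big[op/idx]_(u in heads G) \big[op/idx]_(i < k) F (inl (u, i)))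
     (\big[op/idx]_(e : arc_of G) \big[op/idx]_(j < b) F (inr (e, inr j))).
Proof.
rewrite (eq_bigl _ _ mem_heads_power).
by rewrite (big_power_vertex (mem (heads G)) pred0 predT) big_pred0_eq Monoid.mul1m.
Qed.


End BigPower.

Lemma arc_form_power (R : realType) (z w : W -> R) : (0 < k)%N ->
  arc_form (power G k a b) z w =
  \sum_(e : arc_of G)
    ((\prod_(u in (val e).1) \prod_i z (inl (u, i))) * \prod_i z (inr (e, inl i))) *
    ((\prod_(v in (val e).2) \prod_i w (inl (v, i))) * \prod_j w (inr (e, inr j))).
Proof.
move=> k0; rewrite /arc_form big_imset/=; last by move=> e f _ _; exact: power_arc_inj.
under eq_bigl do rewrite inE.
by apply: eq_bigr => e _; rewrite big_power_tail big_power_head.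
Qed.

Lemma arc_formE (R : realType) (x y : V -> R) :
  arc_form G x y =
  \sum_(e : arc_of G) (\prod_(u in (val e).1) x u) * \prod_(v in (val e).2) y v.
Proof.
exact: (big_sub (arcs G) (fun e => (\prod_(u in e.1) x u) * \prod_(v in e.2) y v)).
Qed.
End PowerSums.

(** * Power means inside the blocks of one arc *)

Section PowerBlocks.
Context {R : realType} {V : finType}.

Lemma powR_prod (I : finType) (A : {set I}) (E : I -> R) (t : R) :
  (forall i, 0 <= E i) ->
  \prod_(i in A) E i `^ t = (\prod_(i in A) E i) `^ t.
Proof.
move=> E0.
suff [] : 0 <= \prod_(i in A) E i /\
    \prod_(i in A) E i `^ t = (\prod_(i in A) E i) `^ t by [].
apply: (big_ind2 (fun q p => 0 <= q /\ p = q `^ t)).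
- by rewrite powR1.
- by move=> p p' q q' [p0 ->] [q0 ->]; rewrite mulr_ge0// powRM.
- by move=> i _; split.
Qed.

Lemma exprn_powR_inv (n : nat) (X : R) : (0 < n)%N -> 0 <= X ->
  `|X `^ n%:R^-1| ^+ n = X.
Proof.
move=> n0 X0; rewrite ger0_norm ?powR_ge0// -powR_mulrn ?powR_ge0// -powRrM.
by rewrite mulVf ?powRr1// pnatr_eq0 -lt0n.
Qed.

(* Holds for n = 0 because x / 0 = 0; with powRr0 this makes the cases a = 0 and
   b = 0 instances of the general computation. *)
Lemma mulr_mean (n : nat) (E : 'I_n -> R) :
  n%:R * ((\sum_i E i) / n%:R) = \sum_i E i.
Proof.
case: n E => [|n] E; first by rewrite mul0r big_ord0.
by rewrite mulrCA mulfV ?mulr1// pnatr_eq0.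
Qed.

Lemma sqrtr_AGM (p q : R) : 0 <= p -> 0 <= q ->
  Num.sqrt p * Num.sqrt q <= (p + q) / 2.
Proof.
move=> p0 q0; rewrite -{2}(sqr_sqrtr p0) -{2}(sqr_sqrtr q0).
have := sqr_ge0 (Num.sqrt p - Num.sqrt q).
by set x := Num.sqrt p; set y := Num.sqrt q => h; nra.
Qed.

Section Block.
Context {r k a : nat} (A : {set V}).
Hypotheses (r0 : (0 < r)%N) (k0 : (0 < k)%N).
Let N := (k * r + a)%N.
Let N0 : (0 < N)%N. Proof. by rewrite addn_gt0 muln_gt0 r0 k0. Qed.

(** The exponent splits as [k / (2 N) = (1 / (2 r)) * (k r / N)]: the first factor turns a block
    mean into a vector entry for [G], the second is theta. *)
Lemma block_prod (S : V -> R) : (forall u, 0 <= S u) ->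
  \prod_(u in A) S u `^ (k%:R / (2 * N)%:R) =
  (\prod_(u in A) S u `^ (2 * r)%:R^-1) `^ ((k * r)%:R / N%:R).
Proof.
move=> S0; rewrite -powR_prod => [|u]; last exact: powR_ge0.
apply: eq_bigr => u _; rewrite -powRrM; congr (_ `^ _).
rewrite !natrM; field.
by rewrite !pnatr_eq0 -!lt0n N0 r0.
Qed.

(** One side of an arc: AM-GM in each block of [k] copies and in the block of [a] new vertices. The
    exponent [a / (2 N)] is half of [a / N], whence the square root. Heads are obtained by using [s]
    and [b] for [r] and [a]. *)
Lemma block_le (z : V -> 'I_k -> R) (z' : 'I_a -> R) :
  `|(\prod_(u in A) \prod_i z u i) * \prod_i z' i| <=
  (\prod_(u in A) ((\sum_i `|z u i| ^+ (2 * N)) / k%:R) `^ (2 * r)%:R^-1)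
    `^ ((k * r)%:R / N%:R) *
  Num.sqrt ((\sum_i `|z' i| ^+ (2 * N)) / a%:R) `^ (a%:R / N%:R).
Proof.
have mean_ge0 (n : nat) (E : 'I_n -> R) :
    0 <= (\sum_i `|E i| ^+ (2 * N)) / n%:R.
  by rewrite divr_ge0// sumr_ge0// => i _; exact: exprn_ge0.
rewrite -block_prod// normrM; apply: ler_pM => //.
  rewrite normr_prod; apply: ler_prod => u _; rewrite normr_ge0/=.
  by apply: ler_norm_prod_mean; rewrite muln_gt0.
rewrite -powR12_sqrt// -powRrM.
rewrite (_ : 2^-1 * (a%:R / N%:R) = a%:R / (2 * N)%:R).
  by apply: ler_norm_prod_mean; rewrite muln_gt0.
by rewrite natrM invfM mulrCA.
Qed.

(** The equality case of [block_le], for vectors constant on each block. *)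
Lemma block_eq (c X : R) (x : V -> R) :
  #|A| = r -> 0 <= c -> 0 <= X -> (forall u, 0 <= x u) ->
  (\prod_(u in A) \prod_(i < k) (c * `|x u| ^+ (2 * r)) `^ (2 * N)%:R^-1) *
    \prod_(i < a) X `^ (2 * N)%:R^-1 =
  (Num.sqrt c * \prod_(u in A) x u) `^ ((k * r)%:R / N%:R) *
    Num.sqrt X `^ (a%:R / N%:R).
Proof.
move=> cA c0 X0 x0; have rN : r%:R != 0 :> R by rewrite pnatr_eq0 -lt0n.
have root_exp (Y : R) (n : nat) : 0 <= Y ->
    \prod_(i < n) Y `^ (2 * N)%:R^-1 = Y `^ (n%:R / (2 * N)%:R).
  move=> Y0; rewrite prodr_const card_ord -powR_mulrn ?powR_ge0// -powRrM.
  by rewrite mulrC.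
have cx0 u : 0 <= c * `|x u| ^+ (2 * r) by rewrite mulr_ge0 ?exprn_ge0.
under eq_bigr do rewrite root_exp//.
rewrite root_exp// block_prod//; congr (_ * _); last first.
  by rewrite -powR12_sqrt// -powRrM natrM invfM mulrCA.
(* Because [#|A| = r], the square root of [c] is a product of [r] equal factors [c ^ (1 / (2 r))],
   one for each vertex of [A]. *)
congr (_ `^ _); rewrite -[X in Num.sqrt X * _](@exprn_powR_inv (2 * r) c) ?muln_gt0//.
rewrite ger0_norm ?powR_ge0// mulnC exprM sqrtr_sqr ger0_norm ?exprn_ge0 ?powR_ge0//.
rewrite -cA -prodr_const -big_split/=; apply: eq_bigr => u _.
rewrite powRM ?exprn_ge0// cA ger0_norm// mulnC -[in LHS]powR_mulrn// -powRrM.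
by rewrite mulfV ?powRr1// pnatr_eq0 -lt0n muln_gt0.
Qed.

End Block.
End PowerBlocks.

(** * The spectral radius of the power *)

Section PowerRadius.
Context {R : realType} {V : finType} {r s : nat} (G : dhypergraph V r s).
Context (k a b : nat).
Hypotheses (r0 : (0 < r)%N) (s0 : (0 < s)%N) (k0 : (0 < k)%N).
Hypothesis ab : (a * s = b * r)%N.
Let N := (k * r + a)%N.
Let M := (k * s + b)%N.
Let theta : R := (k * r)%:R / N%:R.
Let kappa : R := (Num.sqrt (N * M)%:R)^-1.
Let sigma : R := Num.sqrt (r * s)%:R.

Let N0 : (0 < N)%N. Proof. by rewrite addn_gt0 muln_gt0 r0 k0. Qed.
Let M0 : (0 < M)%N. Proof. by rewrite addn_gt0 muln_gt0 s0 k0. Qed.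
Let nz (n : nat) : (0 < n)%N -> n%:R != 0 :> R.
Proof. by rewrite pnatr_eq0 -lt0n. Qed.

Let theta_head : theta = (k * s)%:R / M%:R.
Proof.
apply/eqP; rewrite eqr_div ?nz// -!natrM eqr_nat /N /M; apply/eqP.
by rewrite !mulnDr -!mulnA (mulnA r) (mulnC _ b) (mulnC _ a); nia.
Qed.
Let thetaC : 1 - theta = a%:R / N%:R.
Proof.
by apply/eqP; rewrite subr_eq -mulrDl -natrD addnC eq_sym; apply/eqP/mulfV/nz.
Qed.
Let thetaC_head : 1 - theta = b%:R / M%:R.
Proof.
rewrite theta_head; apply/eqP; rewrite subr_eq -mulrDl -natrD addnC eq_sym.
exact/eqP/mulfV/nz.
Qed.
Let theta01 : 0 < theta <= 1.
Proof.
by rewrite divr_gt0 ?ltr0n ?muln_gt0 ?k0// ler_pdivrMr ?ltr0n// mul1r ler_nat leq_addr.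
Qed.
Let kappa0 : 0 < kappa. Proof. by rewrite invr_gt0 sqrtr_gt0 ltr0n muln_gt0 N0. Qed.
Let sigma0 : 0 < sigma. Proof. by rewrite sqrtr_gt0 ltr0n muln_gt0 r0. Qed.
Let sqrt_div (m n : nat) : (0 < n)%N ->
  Num.sqrt (m%:R / n%:R) = Num.sqrt m%:R / Num.sqrt n%:R :> R.
Proof. by move=> n0; rewrite sqrtrM// sqrtrV. Qed.
(** Both [r / N] and [s / M] equal [theta / k], hence so does their geometric mean, which is
    [kappa * sigma]. *)
Let kappa_sigma : kappa * sigma = theta / k%:R.
Proof.
have kN : k%:R != 0 :> R by exact: nz.
have rsE : Num.sqrt (r%:R / N%:R) * Num.sqrt (s%:R / M%:R) = kappa * sigma.
  by rewrite !sqrt_div// /kappa /sigma !natrM !sqrtrM// invfM; ring.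
have tr : theta / k%:R = r%:R / N%:R by rewrite /theta natrM; field; rewrite nz.
have ts : theta / k%:R = s%:R / M%:R by rewrite theta_head natrM; field; rewrite nz.
by rewrite -rsE -tr -ts -expr2 sqr_sqrtr// divr_ge0// ltW//; case/andP: theta01.
Qed.
(** The right side is the geometric mean of [a / N] and [b / M], and both equal [1 - theta]. *)
Let kappa_ab : 1 - theta = kappa * (Num.sqrt a%:R * Num.sqrt b%:R).
Proof.
have C0 : 0 <= 1 - theta by rewrite thetaC.
rewrite -[LHS]sqr_sqrtr// expr2 {1}thetaC thetaC_head !sqrt_div//.
by rewrite /kappa !natrM !sqrtrM// invfM; ring.
Qed.

Let sum_ge0 (I : finType) (P : pred I) (n : nat) (z : I -> R) :
  0 <= \sum_(u | P u) `|z u| ^+ n.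
Proof. by rewrite sumr_ge0// => i _; exact: exprn_ge0. Qed.

(** Here [m] stands for the spectral radius of [G]. Its bound is taken in homogeneous form because
    the vectors of block means need not have norm 1. *)
Lemma arc_form_power_le (m : R) (z w : power_vertex G k a b -> R) :
  0 < m ->
  (forall x y, arc_form G x y <=
    m * (Num.sqrt (\sum_(u in tails G) `|x u| ^+ (2 * r)) *
         Num.sqrt (\sum_(v in heads G) `|y v| ^+ (2 * s)))) ->
  \sum_(u in tails (power G k a b)) `|z u| ^+ (2 * N) = 1 ->
  \sum_(v in heads (power G k a b)) `|w v| ^+ (2 * M) = 1 ->
  arc_form (power G k a b) z w <= kappa * (sigma * m) `^ theta.
Proof.
move=> m0 ub; rewrite big_tails_power big_heads_power /= => z1 w1.
pose S u := (\sum_(i < k) `|z (inl (u, i))| ^+ (2 * N)) / k%:R.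
pose T v := (\sum_(i < k) `|w (inl (v, i))| ^+ (2 * M)) / k%:R.
pose Q e := (\sum_(i < a) `|z (inr (e, inl i))| ^+ (2 * N)) / a%:R.
pose P e := (\sum_(j < b) `|w (inr (e, inr j))| ^+ (2 * M)) / b%:R.
have S0 u : 0 <= S u by rewrite divr_ge0.
have T0 u : 0 <= T u by rewrite divr_ge0.
have Q0 u : 0 <= Q u by rewrite divr_ge0.
have P0 u : 0 <= P u by rewrite divr_ge0.
(* With these roots, [k] times the power sum of [x] is exactly the part of the norm of [z] carried
   by the copies; likewise for [y] and [w]. *)
pose x u := S u `^ (2 * r)%:R^-1.
pose y v := T v `^ (2 * s)%:R^-1.
pose F (e : arc_of G) := (\prod_(u in (val e).1) x u) * \prod_(v in (val e).2) y v.
have F0 e : 0 <= F e by rewrite mulr_ge0// prodr_ge0// => i _; exact: powR_ge0.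
pose D e := Num.sqrt (Q e) * Num.sqrt (P e).
have D0 e : 0 <= D e by rewrite mulr_ge0.
have f0 : 0 < kappa * (sigma * m) by rewrite !mulr_gt0.
(* Each arc is bounded by the target value times a weight linear in block quantities; the weights
   will add up to at most 1. *)
have term_le (e : arc_of G) :
    ((\prod_(u in (val e).1) \prod_i z (inl (u, i))) * \prod_i z (inr (e, inl i))) *
    ((\prod_(v in (val e).2) \prod_i w (inl (v, i))) * \prod_j w (inr (e, inr j)))
    <= kappa * (sigma * m) `^ theta *
       (k%:R / m * F e + (a%:R * Q e + b%:R * P e) / 2).
  rewrite (le_trans (ler_norm _))// normrM.
  have bz := block_le (val e).1 r0 k0 (fun u i => z (inl (u, i)))
    (fun i => z (inr (e, inl i))).
  have bw := block_le (val e).2 s0 k0 (fun u i => w (inl (u, i)))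
    (fun i => w (inr (e, inr i))).
  apply: le_trans (ler_pM (normr_ge0 _) (normr_ge0 _) bz bw) _.
  rewrite -/N -/M -/theta -theta_head -thetaC -thetaC_head mulrACA -!powRM//;
    try by rewrite prodr_ge0// => i _; exact: powR_ge0.
  rewrite -[X in X `^ theta * _]/(F e) -/(D e).
  (* At the extremal pair both rescaled quantities, [F e / (kappa * (sigma * m))] and [D e / kappa],
     equal the share of [e] in the spectral radius of [G], so weighted AM-GM is sharp there. *)
  have FE : F e = kappa * (sigma * m) * (F e / (kappa * (sigma * m))).
    by rewrite mulrC divfK// gt_eqF.
  have DE : D e = kappa * (D e / kappa) by rewrite mulrC divfK// gt_eqF.
  have kE : kappa = kappa `^ theta * kappa `^ (1 - theta).
    by rewrite -powRD addrC subrK ?powRr1 ?oner_eq0// ltW.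
  have Fd0 : 0 <= F e / (kappa * (sigma * m)) by rewrite divr_ge0// ltW.
  have Dd0 : 0 <= D e / kappa by rewrite divr_ge0// ltW.
  have sm0 : 0 < sigma * m by rewrite mulr_gt0.
  have h := powR_weighted_AGM theta01 Fd0 Dd0.
  have -> : F e `^ theta * D e `^ (1 - theta) = kappa * (sigma * m) `^ theta *
      ((F e / (kappa * (sigma * m))) `^ theta * (D e / kappa) `^ (1 - theta)).
    rewrite {1}FE {1}DE (powRM _ (ltW f0))// !(powRM _ (ltW kappa0))// ?ltW//.
    set B := (_ / _) `^ _; set C := (_ / _) `^ _.
    rewrite [X in _ = X * _ * _]kE; ring.
  rewrite ler_wpM2l//; first by rewrite mulr_ge0 ?powR_ge0// ltW.
  apply: (le_trans h); apply: lerD.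
    rewrite le_eqVlt; apply/predU1P; left.
    (* By [kappa_sigma] the coefficient of [F e] becomes [k / m]. *)
    have -> : theta = k%:R * (kappa * sigma) by rewrite kappa_sigma mulrC divfK// nz.
    by field; rewrite !gt_eqF.
  (* By [kappa_ab] the factor [kappa] cancels, leaving the geometric mean of [a * Q e] and
     [b * P e]. *)
  rewrite kappa_ab mulrC mulrA divfK ?gt_eqF//.
  apply: le_trans (sqrtr_AGM _ _); rewrite ?mulr_ge0//.
  by rewrite (sqrtrM (Q e))// (sqrtrM (P e))// (mulrC (D e)) /D mulrACA.
rewrite arc_form_power// (le_trans (ler_sum _ (fun e _ => term_le e)))//.
rewrite -mulr_sumr -[leRHS]mulr1 ler_wpM2l//; first by rewrite mulr_ge0 ?powR_ge0// ltW.
rewrite big_split/= -mulr_sumr -mulr_suml big_split/= -!mulr_sumr.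
have FE : \sum_(e : arc_of G) F e = arc_form G x y by rewrite arc_formE.
have kS : k%:R * \sum_(u in tails G) `|x u| ^+ (2 * r)
    = \sum_(u in tails G) \sum_(i < k) `|z (inl (u, i))| ^+ (2 * N).
  rewrite mulr_sumr; apply: eq_bigr => u _.
  by rewrite exprn_powR_inv ?muln_gt0// mulr_mean.
have kT : k%:R * \sum_(v in heads G) `|y v| ^+ (2 * s)
    = \sum_(v in heads G) \sum_(i < k) `|w (inl (v, i))| ^+ (2 * M).
  rewrite mulr_sumr; apply: eq_bigr => v _.
  by rewrite exprn_powR_inv ?muln_gt0// mulr_mean.
have aQ : a%:R * \sum_(e : arc_of G) Q e
    = \sum_(e : arc_of G) \sum_(i < a) `|z (inr (e, inl i))| ^+ (2 * N).
  by rewrite mulr_sumr; apply: eq_bigr => e _; rewrite mulr_mean.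
have bP : b%:R * \sum_(e : arc_of G) P e
    = \sum_(e : arc_of G) \sum_(j < b) `|w (inr (e, inr j))| ^+ (2 * M).
  by rewrite mulr_sumr; apply: eq_bigr => e _; rewrite mulr_mean.
rewrite -kS -aQ in z1; rewrite -kT -bP in w1.
have kF : k%:R / m * \sum_(e : arc_of G) F e
    <= k%:R * ((\sum_(u in tails G) `|x u| ^+ (2 * r) +
                \sum_(v in heads G) `|y v| ^+ (2 * s)) / 2).
  rewrite FE -mulrA ler_wpM2l// ler_pdivrMl// (le_trans (ub x y))//.
  by rewrite (ler_wpM2l (ltW m0))// sqrtr_AGM.
(* The total weight is at most half the sum of the norm equations [z1] and [w1], that is 1. *)
by lra.
Qed.

Lemma rho_power_nonempty : arcs G != finset.set0 ->
  rho R (power G k a b) = (sigma * rho R G) `^ theta * kappa.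
Proof.
move=> G0; have [m0 ub [x [y [x0 y0 x1 y1 xy]]]] := rhoP (R := R) r0 s0 G0.
set m := rho R G in m0 ub xy *.
pose F (e : arc_of G) := (\prod_(u in (val e).1) x u) * \prod_(v in (val e).2) y v.
have F0 e : 0 <= F e / m by rewrite divr_ge0 ?(ltW m0)// mulr_ge0 ?prodr_ge0.
(* The copies carry mass [k r / N]. The shares [F e / m] add up to 1, so the new tail vertices carry
   [a / N], and the total is 1; [w] is the analogue with [s], [b], [M]. *)
pose z (v : power_vertex G k a b) : R := match v with
  | inl (u, _) => (r%:R / N%:R * `|x u| ^+ (2 * r)) `^ (2 * N)%:R^-1
  | inr (e, _) => (F e / m / N%:R) `^ (2 * N)%:R^-1 end.
pose w (v : power_vertex G k a b) : R := match v with
  | inl (u, _) => (s%:R / M%:R * `|y u| ^+ (2 * s)) `^ (2 * M)%:R^-1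
  | inr (e, _) => (F e / m / M%:R) `^ (2 * M)%:R^-1 end.
have N20 : (0 < 2 * N)%N by rewrite muln_gt0.
have M20 : (0 < 2 * M)%N by rewrite muln_gt0.
have FE : \sum_(e : arc_of G) F e / m = 1.
  by rewrite -mulr_suml -arc_formE xy mulfV// gt_eqF.
have wgt_ge0 (n p q : nat) (t : R) : 0 <= n%:R / p%:R * `|t| ^+ q.
  by rewrite mulr_ge0 ?exprn_ge0 ?(divr_ge0 (ler0n _ _) (ler0n _ _)).
have F_ge0 e n : 0 <= F e / m / n%:R by exact: divr_ge0 (F0 e) (ler0n _ _).
have zw : arc_form (power G k a b) z w = kappa * (sigma * m) `^ theta.
  rewrite arc_form_power//.
  rewrite (eq_bigr (fun e => kappa * (sigma * m) `^ theta * (F e / m))) => [|e _].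
    by rewrite -mulr_sumr FE mulr1.
  have /and3P[_ /eqP cr /eqP cs] := arcsP (valP e).
  rewrite /= !block_eq ?(divr_ge0 (ler0n _ _) (ler0n _ _))//.
  rewrite -/N -/M -/theta -theta_head -thetaC -thetaC_head.
  have prod_ge0 (A : {set V}) (c : R) (x' : V -> R) :
      (forall u, 0 <= x' u) -> 0 <= Num.sqrt c * \prod_(u in A) x' u.
    by move=> x'0; rewrite mulr_ge0 ?prodr_ge0.
  rewrite mulrACA -(powRM _ (prod_ge0 _ _ _ x0) (prod_ge0 _ _ _ y0)).
  rewrite -(powRM _ (sqrtr_ge0 _) (sqrtr_ge0 _)).
  (* Both bases turn out to be multiples of [F e / m], so the exponents theta and [1 - theta]
     recombine and the arc contributes in proportion to its share. *)
  have -> : Num.sqrt (F e / m / N%:R) * Num.sqrt (F e / m / M%:R) = kappa * (F e / m).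
    rewrite !(sqrtrM _ (F0 e)) mulrACA -expr2 sqr_sqrtr// mulrC; congr (_ * _).
    by rewrite -sqrtrM// -invfM -natrM sqrtrV.
  have -> : Num.sqrt (r%:R / N%:R) * \prod_(u in (val e).1) x u *
      (Num.sqrt (s%:R / M%:R) * \prod_(u in (val e).2) y u) =
      sigma * m * (kappa * (F e / m)).
    rewrite mulrACA -/(F e) !sqrt_div//.
    rewrite /kappa /sigma !natrM !sqrtrM// invfM.
    by field; rewrite !gt_eqF ?sqrtr_gt0 ?ltr0n.
  have kF0 : 0 <= kappa * (F e / m) by rewrite mulr_ge0// ltW.
  move: (F e / m) kF0 => g kF0.
  rewrite (powRM _ (ltW (mulr_gt0 sigma0 m0)) kF0) -[LHS]mulrA.
  rewrite -powRD; last by rewrite addrC subrK oner_eq0.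
  by rewrite addrC subrK powRr1//; ring.
rewrite [RHS]mulrC -zw; apply: rho_eq; rewrite -/N -/M ?N0 ?M0 //.
- rewrite big_tails_power/=.
  under eq_bigr do rewrite sumr_const card_ord exprn_powR_inv//.
  rewrite sumrMnl -mulr_sumr x1 mulr1.
  under [X in _ + X]eq_bigr do rewrite sumr_const card_ord exprn_powR_inv//.
  rewrite sumrMnl -mulr_suml FE -[X in X + _]mulr_natr -[X in _ + X]mulr_natr.
  rewrite (_ : _ + _ = (k%:R * r%:R + a%:R) / N%:R); last by ring.
  by rewrite -natrM -natrD mulfV// nz.
- rewrite big_heads_power/=.
  under eq_bigr do rewrite sumr_const card_ord exprn_powR_inv//.
  rewrite sumrMnl -mulr_sumr y1 mulr1.
  under [X in _ + X]eq_bigr do rewrite sumr_const card_ord exprn_powR_inv//.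
  rewrite sumrMnl -mulr_suml FE -[X in X + _]mulr_natr -[X in _ + X]mulr_natr.
  rewrite (_ : _ + _ = (k%:R * s%:R + b%:R) / M%:R); last by ring.
  by rewrite -natrM -natrD mulfV// nz.
by move=> x' y' x'1 y'1; rewrite zw; exact: arc_form_power_le.
Qed.

End PowerRadius.

Theorem theorem5p11 (R : realType) (V : finType) (r s : nat)
    (hr : (0 < r)%N) (hs : (0 < s)%N) (G : dhypergraph V r s)
    (k a b : nat) (hk : (0 < k)%N) (hab : (a * s = b * r)%N) :
  rho R (power G k a b) =
    (Num.sqrt (r * s)%:R * rho R G) `^ ((k * r)%:R / (k * r + a)%:R)
      / Num.sqrt ((k * r + a) * (k * s + b))%:R.
Proof.
(* Without arcs both radii take the default value 0, and the right side vanishes because the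
   exponent is nonzero. *)
have [G0|G0] := eqVneq (arcs G) finset.set0; last first.
  exact: rho_power_nonempty.
have P0 : arcs (power G k a b) = finset.set0.
  apply/finset.setP => e; rewrite inE.
  by apply/imsetP => -[[f fG]]; have := fG; rewrite {1}G0 inE.
rewrite !rho_no_arc ?addn_gt0 ?muln_gt0 ?hk ?hr//.
rewrite mulr0 powR0 ?mul0r// gt_eqF// divr_gt0 ?ltr0n ?addn_gt0//.
all: by rewrite muln_gt0 hk hr.
Qed.
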